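(* There exist a prime $p$, a finite $p$-group $P$, and a saturated fusion system $\mathcal{F}$ on $P$ such that some indecomposable $\mathcal{F}$-invariant character of $P$ is not a summand of the regular character of $P$.
   Context: A fusion system $\mathcal{F}$ on a finite $p$-group $P$ is a category whose objects are all subgroups of $P$ and whose morphism sets $\mathrm{Hom}_{\mathcal{F}}(Q,R)$ consist of injective group homomorphisms $Q\to R$ such that: (i) every homomorphism $Q\to R$ induced by conjugation with an element of $P$ lies in $\mathrm{Hom}_{\mathcal{F}}(Q,R)$; (ii) every morphism in $\mathcal{F}$ is the composite of an isomorphism in $\mathcal{F}$ followed by an inclusion. It is saturated if every subgroup of $P$ is $\mathcal{F}$-isomorphic to a subgroup $Q\le P$ such that $\mathrm{Aut}_P(Q)$ (the automorphisms of $Q$ induced by $N_P(Q)$) is a Sylow $p$-subgroup of $\mathrm{Aut}_{\mathcal{F}}(Q)$ and every $\mathcal{F}$-isomorphism $\varphi:R\to Q$ extends to a morphism in $\mathcal{F}$ from $N_\varphi=\{g\in N_P(R): \varphi c_g\varphi^{-1}\in\mathrm{Aut}_P(Q)\}$ to $P$, where $c_g$ denotes conjugation by $g$. For any finite group $G$ with Sylow $p$-subgroup $P$, the category with morphisms given by conjugation in $G$ between subgroups of $P$ is a saturated fusion system on $P$. Elements $x,y\in P$ are $\mathcal{F}$-conjugate if there is a morphism $f:\langle x\rangle\to P$ in $\mathcal{F}$ with $f(x)=y$. A complex class function of $P$ is $\mathcal{F}$-invariant if it is constant on the $\mathcal{F}$-conjugacy classes of $P$. Characters are complex characters. A (non-zero)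 $\mathcal{F}$-invariant character of $P$ is indecomposable if it is not the sum of two non-zero $\mathcal{F}$-invariant characters of $P$. A character $\psi$ of $P$ is a summand of a character $\rho$ of $P$ if $\rho-\psi$ is a character of $P$ or zero. *)

(* Defs.v *)
From HB Require Import structures.
From mathcomp Require Import all_boot all_order all_algebra.
From mathcomp Require Import all_fingroup all_solvable all_field all_character.

Set Implicit Arguments.
Unset Strict Implicit.
Unset Printing Implicit Defensive.

Import GroupScope GRing.Theory.

(* A homomorphism Q -> R between subgroups of P is a function on the ambient
   type gT of which only the restriction to Q matters; fhom_ext makes the
   membership in Hom_F(Q, R) depend on that restriction only.  Identities and
   inclusions belong to the category by fhom_conj with x = 1.  As gT is finite,
   taking the Hom sets as boolean predicates loses no generality. *)
Record fusion_system (gT : finGroupType) (P : {group gT}) := FusionSystem {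
  fhom : {group gT} -> {group gT} -> pred (gT -> gT);
  fhom_ext : forall (Q R : {group gT}) (f g : gT -> gT),
    {in Q, f =1 g} -> fhom Q R f = fhom Q R g;
  fhom_obj : forall (Q R : {group gT}) (f : gT -> gT),
    fhom Q R f -> Q \subset P /\ R \subset P;
  fhom_inj_morph : forall (Q R : {group gT}) (f : gT -> gT),
    fhom Q R f ->
    [/\ {in Q &, {morph f : x y / x * y}}, {in Q &, injective f}
      & f @: Q \subset R];
  fhom_comp : forall (Q R S : {group gT}) (f g : gT -> gT),
    fhom Q R f -> fhom R S g -> fhom Q S (g \o f);
  fhom_conj : forall (Q R : {group gT}) (x : gT),
    Q \subset P -> R \subset P -> x \in P -> Q :^ x \subset R ->
    fhom Q R (conjg^~ x);
  (* f is a morphism Q -> S with an inverse S -> Q, followed by the inclusion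
     of S in R. *)
  fhom_factor : forall (Q R : {group gT}) (f : gT -> gT),
    fhom Q R f ->
    exists S : {group gT},
      [/\ S \subset R, fhom Q S f
        & exists g, [/\ fhom S Q g, {in Q, cancel f g} & {in S, cancel g f}]]
}.

Section FusionSystem.

Variables (gT : finGroupType) (P : {group gT}) (F : fusion_system P).
Implicit Types (Q R S : {group gT}) (f : gT -> gT).

Definition fiso Q R f : Prop :=
  fhom F Q R f /\
  exists g, [/\ fhom F R Q g, {in Q, cancel f g} & {in R, cancel g f}].

(* As in Aut Q, an automorphism of Q is encoded as a permutation of gT that
   is the identity outside Q. *)
Definition AutF Q : {set {perm gT}} := [set a in Aut Q | fhom F Q Q a].

Definition AutP Q : {set {perm gT}} := conj_aut Q @* 'N_P(Q).

(* For an isomorphism f : R -> Q, the condition on a : Q -> Q says that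
   f \o c_g \o f^-1 = a, where c_g is y |-> y ^ g.  Since AutP Q is closed
   under inverses, using y ^ g^-1 instead would define the same set. *)
Definition Nphi R Q f : {set gT} :=
  [set g in 'N_P(R) |
    [exists a in AutP Q, [forall y in R, f (y ^ g) == a (f y)]]].

Definition saturated (p : nat) : Prop :=
  forall S, S \subset P ->
  exists Q, [/\ Q \subset P,
    exists f, fiso S Q f,
    p.-Sylow(AutF Q) (AutP Q)
  & forall R f, fiso R Q f ->
    exists2 N : {group gT}, N :=: Nphi R Q f &
      exists2 h, fhom F N P h & {in R, h =1 f}].

Definition fconj (x y : gT) : Prop :=
  exists2 f, fhom F <[x]>%G P f & f x = y.

Definition finvariant (chi : 'CF(P)) : Prop :=
  {in P &, forall x y, fconj x y -> chi x = chi y}.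

(* \is a character also accepts the zero class function. *)
Definition finv_char (chi : 'CF(P)) : Prop :=
  [/\ chi \is a character, chi != 0%R & finvariant chi].

Definition findecomposable (chi : 'CF(P)) : Prop :=
  finv_char chi /\
  ~ (exists chi1 chi2,
       [/\ finv_char chi1, finv_char chi2 & chi = (chi1 + chi2)%R]).

Lemma AutF_group_set Q : Q \subset P -> group_set (AutF Q).
Proof.
move=> sQP.
have inAutF c : (c \in AutF Q) = (c \in Aut Q) && fhom F Q Q c.
  by rewrite in_set.
apply/group_setP; split=> [|a b].
  rewrite inAutF group1 /=.
  rewrite (@fhom_ext _ _ F Q Q _ (conjg^~ 1)) => [|x _]; last first.
    by rewrite perm1 conjg1.
  by apply: fhom_conj; rewrite ?conjsg1.
rewrite !inAutF => /andP[Aa Fa] /andP[Ab Fb]; rewrite groupM //=.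
rewrite (@fhom_ext _ _ F Q Q _ (b \o a)) => [|x _]; last by rewrite permM.
exact: fhom_comp Fa Fb.
Qed.

End FusionSystem.

Definition char_summand (gT : finGroupType) (P : {group gT})
    (psi rho : 'CF(P)) : Prop :=
  (rho - psi)%R \is a character.

(* Main.v *)
Require Import Defs.
From mathcomp Require Import all_boot all_order all_algebra.
From mathcomp Require Import all_fingroup all_solvable all_field all_character.
From mathcomp Require Import zify.

Set Implicit Arguments.
Unset Strict Implicit.
Unset Printing Implicit Defensive.

Import GroupScope GRing.Theory Num.Theory.

(** The counterexample lives in the alternating group G of degree 10 at the
    prime 2.  Its Sylow 2-subgroup P has order 128: it is the wreath product of
    the dihedral group of order 8 with the group of order 2, acting on the
    points 0, ..., 7 by respecting the four blocks {2i, 2i+1} and the two halves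
    {0, ..., 3} and {4, ..., 7}, and made even by exchanging 8 and 9 when
    necessary.  The fusion system of a finite group on a Sylow subgroup is
    saturated (group_fusion_saturated), by Sylow's theorem in the normalisers.

    Two elements of P are conjugate in G as soon as they have the same numbers
    of fixed points for themselves and for their squares (syl_conj_Alt), so
    there are seven classes.  Let pi_k be the permutation character of the
    symmetric group on the subsets with k elements of the ten points.  The
    restriction to P of the irreducible character pi_2 - pi_1 contains the
    trivial character exactly three times, and the example is
       chi = pi_2 - pi_1 - 3,
    of degree 32.  It is a function of the cycle type, hence invariant.

    The group P has eight linear characters, the products of three signs a, b
    and c, where c says whether an element exchanges the two halves.  As chi
    contains c twice, it is not a summand of the regular character.

    An invariant class function psi of P has seven values, so its multiplicities
    satisfy linear relations.  One of them (relation_null) expresses psi(1) by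
    the multiplicities in psi of a c and of six characters orthogonal to chi,
    with coefficient 32 for a c.  If psi is a summand of chi, the last six
    multiplicities vanish, whence psi(1) = 32 '[psi, a c] (degree_face).  But
    '[chi, a c] = 1, so that in a sum of two invariant characters equal to chi
    one of the two has degree 0: chi is indecomposable.

    The finite verifications are done on codes: a permutation x of ten points
    is replaced by the list of its values, and P by the list of its 128
    codes. *)

(** * The fusion system of a finite group *)

Definition group_hom (gT : finGroupType) (G P Q R : {group gT})
    (f : gT -> gT) : bool :=
  [&& Q \subset P, R \subset P
    & [exists g in G, (Q :^ g \subset R) && [forall x in Q, f x == x ^ g]]].

Lemma group_homP (gT : finGroupType) (G P Q R : {group gT}) (f : gT -> gT) :
  reflect [/\ Q \subset P, R \subset P
            & exists g, [/\ g \in G, Q :^ g \subset R & {in Q, f =1 conjg^~ g}]]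
          (group_hom G P Q R f).
Proof.
apply: (iffP and3P) => [[sQP sRP]|[sQP sRP [g [Gg sQgR fE]]]].
  case/existsP=> g /and3P[Gg sQgR /forall_inP fE].
  by split=> //; exists g; split=> // x Qx; apply/eqP/fE.
split=> //; apply/existsP; exists g; rewrite Gg sQgR.
by apply/forall_inP=> x Qx; apply/eqP/fE.
Qed.

Definition group_fusion (gT : finGroupType) (G P : {group gT})
  (sPG : P \subset G) : fusion_system P.
Proof.
refine (@FusionSystem gT P (group_hom G P) _ _ _ _ _ _).
- move=> Q R f g eqfg; congr [&& _, _ & _].
  apply: eq_existsb => z; congr [&& _, _ & _].
  apply/eq_forallb_in => x Qx; by rewrite eqfg.
- by move=> Q R f /group_homP[].
- move=> Q R f /group_homP[_ _ [g [_ sQgR fE]]]; split.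
  + by move=> x y Qx Qy; rewrite !fE ?groupM // conjMg.
  + by move=> x y Qx Qy; rewrite !fE //; apply: conjg_inj.
  apply/subsetP=> _ /imsetP[x Qx ->].
  by rewrite fE // (subsetP sQgR) ?memJ_conjg.
- move=> Q R S f g /group_homP[sQP _ [a [Ga sQaR fE]]].
  case/group_homP=> _ sSP [b [Gb sRbS gE]].
  apply/group_homP; split=> //; exists (a * b); split; first exact: groupM.
    by rewrite conjsgM (subset_trans _ sRbS) // conjSg.
  move=> x Qx /=; rewrite fE // gE ?conjgM //.
  by rewrite (subsetP sQaR) ?memJ_conjg.
- move=> Q R x sQP sRP Px sQxR; apply/group_homP; split=> //.
  by exists x; split=> //; apply: (subsetP sPG).
move=> Q R f /group_homP[sQP sRP [g [Gg sQgR fE]]].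
exists (Q :^ g)%G; split=> //.
  apply/group_homP; split=> //; first exact: subset_trans sRP.
  by exists g; split.
exists (conjg^~ g^-1); split.
- apply/group_homP; split=> //; first exact: subset_trans sRP.
  exists g^-1; split=> //; first by rewrite groupV.
  by rewrite /= conjsgK.
- by move=> x Qx /=; rewrite fE // conjgK.
move=> _ /imsetP[x Qx ->] /=; by rewrite conjgK fE.
Defined.

Lemma group_fusion_fconjP (gT : finGroupType) (G P : {group gT})
    (sPG : P \subset G) (x y : gT) : x \in P -> y \in P ->
  (fconj (group_fusion sPG) x y <-> exists2 g, g \in G & x ^ g = y).
Proof.
move=> Px Py; split=> [[f /group_homP[_ _ [g [Gg _ fE]]] <-]|[g Gg def_y]].
  by exists g => //; rewrite fE ?cycle_id.
exists (conjg^~ g) => //; apply/group_homP; split=> //.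
  by rewrite cycle_subG.
exists g; split=> //.
by rewrite -cycleJ def_y cycle_subG.
Qed.

(** Given S, conjugate it so that the Sylow subgroup of its normaliser in G
    falls into P: the result Q has N_P(Q) Sylow in N_G(Q), which gives the Sylow
    condition on automorphisms.  If conjugation by u maps R to Q, the conjugate
    by u of N_phi lies in N_P(Q) C_G(Q), in which N_P(Q) is still Sylow, so that
    an element of C_G(Q) moves it into P without changing the map on R. *)
Lemma group_fusion_saturated (gT : finGroupType) (G P : {group gT})
    (sPG : P \subset G) (p : nat) :
  p.-Sylow(G) P -> saturated (group_fusion sPG) p.
Proof.
move=> sylP S sSP; have pP := pHall_pgroup sylP.
have [T sylT] := Sylow_exists p 'N_G(S).
have sTNS := pHall_sub sylT; have pT := pHall_pgroup sylT.
have [g Gg sTgP] : exists2 g, g \in G & T \subset P :^ g.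
  by apply: Sylow_subJ sylP _ pT; apply: subset_trans sTNS (subsetIl _ _).
have sST : S \subset T.
  have nsSN : S <| 'N_G(S) by rewrite normalSG // (subset_trans sSP).
  rewrite (normal_sub_max_pgroup (Hall_max sylT)) //.
  exact: pgroupS sSP pP.
pose Q := (S :^ g^-1)%G; have sQP : Q \subset P.
  by rewrite /= sub_conjgV (subset_trans sST).
(* N_P(Q) contains the conjugate of the Sylow subgroup T of N_G(S). *)
have sylN : p.-Sylow('N_G(Q)) 'N_P(Q).
  have sylTg : p.-Sylow('N_G(Q)) (T :^ g^-1).
    have -> : 'N_G(Q) = 'N_G(S) :^ g^-1.
      by rewrite conjIg normJ conjGid ?groupV.
    by rewrite pHallJ2.
  have sTN : T :^ g^-1 \subset 'N_P(Q).
    rewrite subsetI sub_conjgV sTgP /=.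
    by rewrite (subset_trans (pHall_sub sylTg)) ?subsetIr.
  have pN : p.-group 'N_P(Q) by apply: pgroupS pP; apply: subsetIl.
  have sNN : 'N_P(Q) \subset 'N_G(Q) by rewrite setSI.
  have /maxgroupP[_ maxT] := Hall_max sylTg.
  have defT : 'N_P(Q) = T :^ g^-1 by apply: (maxT 'N_P(Q)%G) => //; apply/andP.
  by rewrite defT.
exists Q; split=> //.
- exists (conjg^~ g^-1); split.
    apply/group_homP; split=> //; exists g^-1; split=> //.
    by rewrite groupV.
  exists (conjg^~ g); split.
  + apply/group_homP; split=> //; exists g; split=> //.
    by rewrite /= conjsgKV.
  + by move=> x _ /=; rewrite conjgKV.
  by move=> x _ /=; rewrite conjgK.
- have -> : AutF (group_fusion sPG) Q = conj_aut Q @* 'N_G(Q).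
    apply/setP=> a; rewrite inE; apply/andP/morphimP.
      case=> Aa /group_homP[_ _ [u [Gu sQuQ aE]]].
      have Nu : u \in 'N(Q) by rewrite inE.
      exists u => //; first by rewrite inE Gu.
      apply: eq_Aut Aa (Aut_aut _ _) _ => x Qx.
      by rewrite norm_conj_autE // aE.
    case=> u Nu /setIP[Gu _] ->; split; first exact: Aut_aut.
    apply/group_homP; split=> //; exists u; split=> //.
      by rewrite (normP Nu).
    by move=> x Qx; rewrite norm_conj_autE.
  apply: morphim_pHall sylN; exact: subsetIr.
move=> R f [/group_homP[sRP _ [u [Gu sRuQ fE]]] [f' [homf' _ f'K]]].
have defQ : Q :=: R :^ u.
  apply/eqP; rewrite eqEsubset sRuQ andbT; apply/subsetP=> x Qx.
  have [_ _ sf'] := fhom_inj_morph homf'.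
  have Rf'x : f' x \in R by rewrite (subsetP sf') ?imset_f.
  by rewrite -(f'K x Qx) fE // memJ_conjg.
have nNC : 'N_P(Q) \subset 'N('C_G(Q)).
  rewrite normsI ?norms_cent ?subsetIr //.
  by rewrite (subset_trans (subsetIl _ _)) // (subset_trans sPG) ?normG.
have defM : 'N_P(Q) <*> 'C_G(Q) = 'N_P(Q) * 'C_G(Q) by rewrite norm_joinEl.
pose M := ('N_P(Q) <*> 'C_G(Q))%G.
have defN : Nphi P R Q f = 'N_P(R) :&: M :^ u^-1.
  apply/setP=> x; rewrite [LHS]inE [RHS]inE; apply: andb_id2l => /setIP[Px NRx].
  rewrite mem_conjgV /= defM.
  have NQxu : x ^ u \in 'N(Q) by rewrite defQ normJ memJ_conjg.
  have Gxu : x ^ u \in G by rewrite groupJ // (subsetP sPG).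
  apply/existsP/mulsgP=> [[a /andP[/morphimP[v NQv NPv ->] /forall_inP eqa]]|].
    exists v (v^-1 * x ^ u) => //; last by rewrite mulKVg.
    have [Pv _] := setIP NPv.
    rewrite inE groupM ?groupV // ?(subsetP sPG) //=.
    apply/centP=> y Qy; apply/esym/commgP/conjg_fixP; rewrite conjgM.
    have Qyv : y ^ v^-1 \in Q by rewrite memJ_norm ?groupV.
    move: (Qyv); rewrite {1}defQ => /imsetP[z Rz def_z].
    have := eqP (eqa z Rz).
    rewrite !fE ?memJ_norm // norm_conj_autE -?def_z // conjgKV.
    by rewrite def_z -conjJg.
  case=> v c NPv /setIP[Gc Cc] def_xu; have [Pv NQv] := setIP NPv.
  exists (conj_aut Q v); rewrite mem_morphim //=; apply/forall_inP=> y Ry.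
  have Qyu : y ^ u \in Q by rewrite defQ memJ_conjg.
  rewrite !fE ?memJ_norm // norm_conj_autE // conjJg def_xu conjgM.
  apply/eqP/conjg_fixP/commgP/esym/(centP Cc).
  by rewrite memJ_norm.
have sylM : p.-Sylow(M) 'N_P(Q).
  apply: pHall_subl sylN; rewrite /= ?joing_subl // defM.
  by rewrite mul_subG ?setSI // subsetI subsetIl subIset ?cent_sub ?orbT.
pose N := ('N_P(R) :&: M :^ u^-1)%G.
have [m Mm sNm] : exists2 m, m \in M & N :^ u \subset 'N_P(Q) :^ m.
  apply: Sylow_subJ sylM _ _; first by rewrite sub_conjg subsetIr.
  by rewrite pgroupJ (pgroupS _ pP) // /= -setIA subsetIl.
move: Mm; rewrite /= defM => /mulsgP[v c NPv /setIP[Gc Cc] def_m].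
exists N; first by rewrite defN.
exists (conjg^~ (u * c^-1)).
  apply/group_homP; split=> //; first by rewrite /= -setIA subsetIl.
  exists (u * c^-1); split=> //; first by rewrite groupM ?groupV.
  rewrite conjsgM sub_conjgV (subset_trans sNm) // def_m conjsgM conjSg.
  by rewrite conjGid // subsetIl.
move=> x Rx /=; rewrite fE // conjgM.
apply/conjg_fixP/commgP/esym/(centP (groupVr Cc)).
by rewrite defQ memJ_conjg.
Qed.

(** * Monomial characters *)

(** The matrices which permute the basis X with signs form a representation as
    soon as the signs satisfy the cocycle condition; its trace counts the fixed
    basis vectors with signs.  Permutation characters and linear characters with
    values in {1, -1} are the cases of trivial signs and of one basis vector. *)
Lemma monomial_char (gT : finGroupType) (P : {group gT}) (T : eqType)
    (X : seq T) (act : gT -> T -> T) (sgn : gT -> T -> bool) :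
    uniq X ->
    {in P & X, forall x p, act x p \in X} ->
    {in X, forall p, act 1 p = p /\ sgn 1 p = false} ->
    {in P & P & X, forall x y p, act (x * y) p = act y (act x p)
                       /\ sgn (x * y) p = sgn x p (+) sgn y (act x p)} ->
  exists2 phi : 'CF(P), phi \is a character
    & {in P, forall x,
        phi x = (\sum_(p <- X | act x p == p) (-1) ^+ sgn x p)%R}.
Proof.
move=> uX actX act1 actM.
pose n := size X; pose pt (i : 'I_n) := tnth (in_tuple X) i.
have ptX i : pt i \in X by apply: mem_tnth.
have pt_inj : injective pt by apply/tuple_uniqP.
have ptK p : p \in X -> exists i, pt i = p.
  by case/(tnthP (in_tuple X)) => i ->; exists i.
pose M x : 'M[algC]_n :=
  (\matrix_(i, j) (if act x (pt i) == pt j then (-1) ^+ sgn x (pt i) else 0))%R.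
have reprM : mx_repr P M.
  split=> [|x y Px Py]; apply/matrixP=> i j.
    have [def1 sgn1] := act1 _ (ptX i).
    by rewrite !mxE def1 sgn1 (inj_eq pt_inj) expr0; case: eqP.
  have [k def_k] := ptK _ (actX _ _ Px (ptX i)).
  rewrite !mxE (bigD1 k) //= big1 => [|l lk]; last first.
    by rewrite !mxE -def_k (inj_eq pt_inj) eq_sym (negPf lk) mul0r.
  rewrite !mxE def_k eqxx addr0.
  have [-> ->] := actM _ _ _ Px Py (ptX i).
  by rewrite signr_addb; case: ifP; rewrite ?mulr0.
exists (cfRepr (MxRepresentation reprM)); first exact: cfRepr_char.
move=> x Px; rewrite cfunE Px mulr1n /mxtrace.
transitivity
  (\sum_(i < n | act x (pt i) == pt i) (-1) ^+ sgn x (pt i) : algC)%R.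
  by rewrite [RHS]big_mkcond; apply: eq_bigr => i _; rewrite mxE.
by rewrite -(big_tnth _ _ X (fun p => act x p == p)
                 (fun p => (-1) ^+ sgn x p)%R).
Qed.

Lemma char_subr_lin (gT : finGroupType) (P : {group gT}) (phi lam : 'CF(P))
    (m n : nat) : phi \is a character -> lam \is a linear_char ->
    ('[phi, lam] = m%:R)%R -> n <= m ->
  (phi - lam *+ n)%R \is a character.
Proof.
move=> Nphi /lin_char_irr/irrP[i ->] phi_i le_nm.
rewrite [X in (X - _)%R]cfun_sum_cfdot (bigD1 i) //= phi_i addrAC.
rewrite scaler_nat -mulrnBr // rpredD ?rpredMn ?irr_char //.
apply: rpred_sum => j _; have /natrP[k ->] := Cnat_cfdot_char_irr j Nphi.
by rewrite scaler_nat rpredMn ?irr_char.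
Qed.

(** * Permutations of ten points as lists of values *)

Definition code (x : {perm 'I_10}) : seq nat :=
  [seq val (x i) | i <- enum 'I_10].

(** Permutations act on the right: s is applied before t. *)
Definition code_mul (s t : seq nat) : seq nat := [seq nth 0 t i | i <- s].

Lemma nth_code x (i : 'I_10) : nth 0 (code x) i = x i.
Proof. by rewrite (nth_map i) ?size_enum_ord // nth_ord_enum. Qed.

Lemma code_inj : injective code.
Proof.
move=> x y eqxy; apply/permP=> i; apply: val_inj.
by rewrite /= -!nth_code eqxy.
Qed.

Lemma code1 : code 1 = iota 0 10.
Proof. by rewrite -val_enum_ord; apply: eq_map => i; rewrite perm1. Qed.

Lemma codeM x y : code (x * y) = code_mul (code x) (code y).
Proof.
rewrite /code_mul -map_comp; apply: eq_map => i /=.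
by rewrite nth_code permM.
Qed.

Lemma code_perm (s : seq nat) :
    [&& size s == 10, uniq s & all (fun i => i < 10) s] ->
  exists x, code x = s.
Proof.
case/and3P=> /eqP sz_s Us /allP s_lt.
have s_lti (i : 'I_10) : nth 0 s i < 10 by rewrite s_lt ?mem_nth ?sz_s.
have f_inj : injective (fun i : 'I_10 => Ordinal (s_lti i)).
  move=> i j [] /eqP; rewrite nth_uniq ?sz_s // => /eqP; exact: val_inj.
exists (perm f_inj); apply: (@eq_from_nth _ 0).
  by rewrite size_map size_enum_ord.
move=> i; rewrite size_map size_enum_ord => lti.
by rewrite (nth_code _ (Ordinal lti)) permE.
Qed.

Definition swap (a b i : nat) := if i == a then b else if i == b then a else i.

Lemma code_tperm (a b : 'I_10) :
  code (tperm a b) = [seq swap a b i | i <- iota 0 10].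
Proof.
rewrite -val_enum_ord -map_comp; apply: eq_map => i /=.
rewrite /swap !val_eqE; case: tpermP => [->|->|/eqP/negPf-> /eqP/negPf->] //.
  by rewrite eqxx.
by rewrite eqxx; case: eqP => // ->.
Qed.

Definition swap_perm (l : seq (nat * nat)) : {perm 'I_10} :=
  \prod_(ab <- l) tperm (inord ab.1) (inord ab.2).

Definition swap_code (l : seq (nat * nat)) : seq nat :=
  [seq foldl (fun i ab => swap ab.1 ab.2 i) i l | i <- iota 0 10].

Definition proper_swaps (l : seq (nat * nat)) : bool :=
  all (fun ab => [&& ab.1 < 10, ab.2 < 10 & ab.1 != ab.2]) l.

Lemma code_swap_perm l : proper_swaps l -> code (swap_perm l) = swap_code l.
Proof.
rewrite /swap_perm; elim/last_ind: l => [|l [a b] IHl].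
  by rewrite big_nil code1.
rewrite /proper_swaps all_rcons /= => /andP[/and3P[lta ltb _] proper_l].
rewrite big_rcons codeM IHl // code_tperm /code_mul /swap_code -map_comp.
apply/eq_in_map => i; rewrite mem_iota /= => lti.
have lt_i' : foldl (fun i ab => swap ab.1 ab.2 i) i l < 10.
  elim: l proper_l i lti {IHl} => //= [[c d] l IHl] /andP[/and3P[ltc ltd _]].
  by move=> proper_l i lti; apply: IHl => //=; rewrite /swap; do ?case: ifP.
move: lt_i'; rewrite foldl_rcons; move: (foldl _ i l) => k ltk.
rewrite -[LHS]/(nth 0 [seq swap _ _ j | j <- iota 0 10] k).
by rewrite (nth_map 0) ?size_iota // nth_iota //= (inordK lta) (inordK ltb).
Qed.

Lemma odd_swap_perm l : proper_swaps l -> odd_perm (swap_perm l) = odd (size l).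
Proof.
rewrite /swap_perm; elim: l => [|[a b] l IHl] /=.
  by rewrite big_nil odd_perm1.
case/andP=> /and3P[lta ltb ab] /IHl{}IHl.
by rewrite big_cons odd_mul_tperm IHl -val_eqE /= (inordK lta) (inordK ltb) ab.
Qed.

(** * A Sylow 2-subgroup of the alternating group *)

(** The exchange of the two points of a block (made even by the exchange of 8
    and 9), of the two blocks of a half, and of the two halves. *)
Definition syl_gens : seq (seq (nat * nat)) :=
  [:: [:: (0, 1); (8, 9)]; [:: (2, 3); (8, 9)];
      [:: (4, 5); (8, 9)]; [:: (6, 7); (8, 9)];
      [:: (0, 2); (1, 3)]; [:: (4, 6); (5, 7)];
      [:: (0, 4); (1, 5); (2, 6); (3, 7)]]%N.

Definition syl : {group {perm 'I_10}} :=
  <<[set x in map swap_perm syl_gens]>>%G.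

(** Every element has a unique normal form as a product, in the order of
    syl_gens, of some of the seven generators. *)
Definition syl_codes : seq (seq nat) :=
  foldl (fun A l => A ++ [seq code_mul s (swap_code l) | s <- A])
    [:: iota 0 10] syl_gens.

Lemma proper_syl_gens : all proper_swaps syl_gens.
Proof. by vm_compute. Qed.

Lemma syl_ind (Q : {perm 'I_10} -> Prop) :
    Q 1 ->
    (forall x l, x \in syl -> Q x -> l \in syl_gens -> Q (x * swap_perm l)) ->
  {in syl, forall x, Q x}.
Proof.
move=> Q1 QM _ /gen_prodgP[n [c gen_c ->]].
elim: n c gen_c => [|n IHn] c gen_c; first by rewrite big_ord0.
rewrite big_ord_recr /=; have := gen_c ord_max.
rewrite inE => /mapP[l gen_l ->]; apply: QM => //; last exact: IHn.
by apply: group_prod => i _; apply: mem_gen.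
Qed.

Lemma swap_perm_syl l : l \in syl_gens -> swap_perm l \in syl.
Proof. by move=> gen_l; rewrite mem_gen // inE map_f. Qed.

Lemma code_syl : {in syl, forall x, code x \in syl_codes}.
Proof.
apply: syl_ind => [|x l _ Lx gen_l]; first by rewrite code1.
rewrite codeM code_swap_perm; last exact: (allP proper_syl_gens).
have: all (fun s =>
        all (fun l => code_mul s (swap_code l) \in syl_codes) syl_gens) syl_codes.
  by vm_compute.
by move/allP=> /(_ _ Lx)/allP; apply.
Qed.

Lemma syl_codesP s : s \in syl_codes -> exists2 x, x \in syl & code x = s.
Proof.
rewrite /syl_codes; have: {subset syl_gens <= syl_gens} by [].
elim/last_ind: {1 3}syl_gens s => [|ls l IHl] s sub.
  by rewrite inE => /eqP->; exists 1; rewrite ?group1 ?code1.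
have sub_ls : {subset ls <= syl_gens}.
  by move=> k k_ls; rewrite sub // mem_rcons inE k_ls orbT.
have gen_l : l \in syl_gens by rewrite sub // mem_rcons mem_head.
rewrite foldl_rcons mem_cat => /orP[/(IHl _ sub_ls) //|/mapP[t]].
case/(IHl _ sub_ls) => x Px <- ->; exists (x * swap_perm l).
  by rewrite groupM ?swap_perm_syl.
by rewrite codeM code_swap_perm // (allP proper_syl_gens).
Qed.

Lemma perm_syl_codes : perm_eq [seq code x | x <- enum syl] syl_codes.
Proof.
apply: uniq_perm; first by rewrite map_inj_uniq ?enum_uniq //; apply: code_inj.
  by vm_compute.
move=> s; apply/mapP/idP => [[x]|/syl_codesP[x Px <-]].
  by rewrite mem_enum => Px ->; apply: code_syl.
by exists x; rewrite ?mem_enum.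
Qed.

Lemma card_syl : #|syl| = 128.
Proof.
by rewrite cardE -(size_map code) (perm_size perm_syl_codes); vm_compute.
Qed.

Lemma sum_syl (V : nmodType) (f : seq nat -> V) :
  (\sum_(x in syl) f (code x) = \sum_(s <- syl_codes) f s)%R.
Proof.
by rewrite -(perm_big _ perm_syl_codes) big_map /= big_enum.
Qed.

Lemma syl_sub_Alt : syl \subset 'Alt_('I_10).
Proof.
rewrite gen_subG; apply/subsetP=> x; rewrite inE => /mapP[l gen_l ->].
rewrite Alt_even /= odd_swap_perm ?(allP proper_syl_gens) //.
have: all (fun l => ~~ odd (size l)) syl_gens by vm_compute.
by move/allP; apply.
Qed.

(** Half of the factorial of 10 is 128 times the odd number 105 * 135. *)
Lemma syl_Sylow : 2.-Sylow('Alt_('I_10)) syl.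
Proof.
have := Lagrange syl_sub_Alt; rewrite /pHall syl_sub_Alt card_syl.
have := @card_Alt 'I_10; rewrite card_ord => /(_ isT).
move: #|'Alt__| #|_ : _| => n m cardA cardn.
have -> : m = (105 * 135)%N by rewrite !factS fact0 in cardA; lia.
by rewrite /pgroup card_syl (_ : 128 = (2 ^ 7)%N) // pnatX p'natE.
Qed.

(** * Fusion is detected by fixed points *)

(* Unification must not enumerate the 128 codes; vm_compute still does. *)
Opaque syl_codes.

Definition nfix (s : seq nat) : nat :=
  count (fun i => nth 0 s i == i) (iota 0 10).

Definition fix_type (s : seq nat) : nat * nat := (nfix s, nfix (code_mul s s)).

Lemma nfix_code x : nfix (code x) = #|[set i | x i == i]|.
Proof.
rewrite cardsE cardE /nfix -val_enum_ord count_map size_filter.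
by rewrite enumT; apply: eq_count => i /=; rewrite nth_code.
Qed.

Lemma nfixJ x g : nfix (code (x ^ g)) = nfix (code x).
Proof.
rewrite !nfix_code -[RHS](card_imset _ (@perm_inj _ g)); congr #|pred_of_set _|.
apply/setP=> i; rewrite inE; apply/eqP/imsetP => [fix_i|[j + ->]].
  exists (g^-1 i); last by rewrite permKV.
  by rewrite inE -(inj_eq (@perm_inj _ g)) permKV -{2}fix_i !permM.
by rewrite inE => /eqP fix_j; rewrite permJ fix_j.
Qed.

Lemma fix_typeJ x g : fix_type (code (x ^ g)) = fix_type (code x).
Proof. by rewrite /fix_type -!codeM -conjMg !nfixJ. Qed.

(** The points listed cycle after cycle, by increasing length of the cycles.  If
    two permutations have the same cycle type, then sending one list to the
    other conjugates the first permutation to the second. *)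
Definition cycle_word (s : seq nat) : seq nat :=
  let orb i := traject (nth 0 s) i 10 in
  flatten (sort (fun c d => size c <= size d)
    [seq undup (orb i) | i <- iota 0 10 & all (leq i) (orb i)]).

Definition conj_code (s t : seq nat) : seq nat :=
  [seq nth 0 (cycle_word t) (index i (cycle_word s)) | i <- iota 0 10].

(** The representative z is the first element in the enumeration of P with the
    same numbers of fixed points; each of the 128 conjugations is verified. *)
Lemma syl_conj_Sym x : x \in syl ->
  exists z g, code z = nth [::] syl_codes
     (index (fix_type (code x)) (map fix_type syl_codes)) /\ x ^ g = z.
Proof.
move/code_syl => Lx.
have: let types := map fix_type syl_codes in
      all (fun s => let t := nth [::] syl_codes (index (fix_type s) types) in
        let w := conj_code s t in
        [&& size w == 10, uniq w, all (fun i => i < 10) w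
          & code_mul s w == code_mul w t]) syl_codes by vm_compute.
move/allP=> /(_ _ Lx); cbv zeta; set t := nth _ _ _; set w := conj_code _ _.
case/and4P=> sz_w Uw w_lt /eqP xw.
have [g code_g] : exists g, code g = w by apply: code_perm; apply/and3P.
have /syl_codesP[z _ code_z] : t \in syl_codes.
  by rewrite mem_nth // -(size_map fix_type) index_mem map_f.
exists z, g; split=> //; apply: (mulgI g); rewrite -conjgC.
by apply: code_inj; rewrite !codeM code_g code_z.
Qed.

Lemma syl_centralised x : x \in syl -> commute x (swap_perm [:: (8, 9)%N]).
Proof.
move/code_syl => Lx; apply: code_inj; rewrite !codeM code_swap_perm //.
have: all (fun s => code_mul s (swap_code [:: (8, 9)%N])
        == code_mul (swap_code [:: (8, 9)%N]) s) syl_codes by vm_compute.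
by move/allP=> /(_ _ Lx)/eqP.
Qed.

(** A conjugating permutation can be corrected by the transposition of 8 and 9,
    which is odd and centralises P, so fusion in the symmetric group is the same
    as fusion in the alternating group. *)
Lemma syl_conj_Alt x y :
    x \in syl -> y \in syl -> fix_type (code x) = fix_type (code y) ->
  exists2 g, g \in 'Alt_('I_10) & x ^ g = y.
Proof.
move=> Px Py eqxy; have [z [g [code_z xg]]] := syl_conj_Sym Px.
have [z' [h [code_z' yh]]] := syl_conj_Sym Py.
have {code_z' code_z} def_z' : z' = z.
  by apply: code_inj; rewrite code_z' -eqxy -code_z.
have xgh : x ^ (g * h^-1) = y by rewrite conjgM xg -def_z' -yh conjgK.
have [odd_gh|] := boolP (odd_perm (g * h^-1)); last first.
  by move=> ev; exists (g * h^-1); rewrite ?Alt_even.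
exists (swap_perm [:: (8, 9)%N] * (g * h^-1)).
  by rewrite Alt_even odd_permM odd_gh odd_swap_perm.
rewrite conjgM -[RHS]xgh; congr (_ ^ _).
by apply/conjg_fixP/commgP/syl_centralised.
Qed.

Definition fusion10 : fusion_system syl := group_fusion syl_sub_Alt.

Lemma fusion10_invariantP (phi : 'CF(syl)) :
  finvariant fusion10 phi <->
  {in syl &, forall x y,
      fix_type (code x) = fix_type (code y) -> phi x = phi y}.
Proof.
split=> [inv x y Px Py /(syl_conj_Alt Px Py) conj_xy | inv x y Px Py].
  by apply: inv => //; apply/(group_fusion_fconjP syl_sub_Alt Px Py).
case/(group_fusion_fconjP syl_sub_Alt Px Py) => g _ def_y.
by apply: inv => //; rewrite -def_y fix_typeJ.
Qed.

(** * Class functions given on codes *)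

Definition takes (phi : 'CF(syl)) (z : seq nat -> int) : Prop :=
  {in syl, forall x, phi x = (z (code x))%:~R%R}.

Definition dot (z w : seq nat -> int) : int :=
  foldr (fun s v => z s * w s + v)%R 0%R syl_codes.

Lemma dotE z w : dot z w = (\sum_(s <- syl_codes) z s * w s)%R.
Proof. by rewrite unlock. Qed.

Lemma takes_cfdot phi psi z w n : takes phi z -> takes psi w ->
  dot z w = (128 * n)%R -> ('[phi, psi] = n%:~R)%R.
Proof.
move=> phi_z psi_w dot_n; rewrite cfdotE card_syl.
have -> : (\sum_(x in syl) phi x * (psi x)^*)%R = ((dot z w)%:~R : algC)%R.
  rewrite dotE rmorph_sum -sum_syl /=; apply: eq_bigr => x Px.
  by rewrite phi_z // psi_w // rmorph_int -intrM.
by rewrite dot_n intrM mulKf // pnatr_eq0.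
Qed.

Definition monomial_trace (T : eqType) (X : seq T)
    (act : seq nat -> T -> T) (sgn : seq nat -> T -> bool)
    (s : seq nat) : int :=
  foldr (fun p v => if act s p == p then (-1) ^+ sgn s p + v else v)%R 0%R X.

(** The cocycle condition is only tested for a generator as second factor:
    syl_ind extends it to products. *)
Definition monomial_ok (T : eqType) (X : seq T)
    (act : seq nat -> T -> T) (sgn : seq nat -> T -> bool) : bool :=
  [&& uniq X,
      all (fun p => (act (iota 0 10) p == p) && ~~ sgn (iota 0 10) p) X
    & all (fun s => all (fun p => (act s p \in X) && all (fun l =>
             let t := swap_code l in let st := code_mul s t in
             (act st p == act t (act s p))
             && (sgn st p == sgn s p (+) sgn t (act s p)))
           syl_gens) X) syl_codes].

Lemma monomial_trace_char (T : eqType) (X : seq T)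
    (act : seq nat -> T -> T) (sgn : seq nat -> T -> bool) :
    monomial_ok X act sgn ->
  exists2 phi : 'CF(syl), phi \is a character
    & takes phi (monomial_trace X act sgn).
Proof.
case/and3P=> uX /allP X1 /allP XM.
have [||||phi Nphi phiE] := @monomial_char _ syl T X
    (fun x => act (code x)) (fun x => sgn (code x)); first exact: uX.
- move=> x p Px Xp; have /allP/(_ p Xp) := XM _ (code_syl Px).
  by case/andP.
- move=> p /X1; rewrite code1 => /andP[/eqP-> /negPf->] //.
- move=> x y p Px Py; move: p; pattern y; move: y Py; apply: syl_ind.
    move=> p Xp; rewrite mulg1 code1.
    have /allP/(_ p Xp)/andP[Xxp _] := XM _ (code_syl Px).
    by have /andP[/eqP-> /negPf->] := X1 _ Xxp; rewrite addbF.
  move=> y l Py IHy gen_l p Xp.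
  have /allP/(_ p Xp)/andP[Xxp _] := XM _ (code_syl Px).
  have /allP/(_ _ Xxp)/andP[_ /allP/(_ l gen_l)] := XM _ (code_syl Py).
  have /allP/(_ _ Xp)/andP[_ /allP/(_ l gen_l)] :=
    XM _ (code_syl (groupM Px Py)).
  have [xyp sgn_xyp] := IHy p Xp.
  cbv zeta; rewrite -code_swap_perm ?(allP proper_syl_gens) // -!codeM.
  rewrite mulgA => /andP[/eqP-> /eqP->] /andP[/eqP-> /eqP->].
  by rewrite xyp sgn_xyp addbA.
exists phi => // x Px; rewrite phiE // /monomial_trace.
elim: (X) => [|p Y IHY]; first by rewrite big_nil.
rewrite big_cons IHY /=; case: ifP => // _.
by rewrite rmorphD rmorphXn /= rmorphN1.
Qed.

Definition linear_trace (sg : seq nat -> bool) : seq nat -> int :=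
  monomial_trace [:: tt] (fun _ p => p) (fun s _ => sg s).

Definition linear_ok (sg : seq nat -> bool) : bool :=
  monomial_ok [:: tt] (fun _ p => p) (fun s _ => sg s).

Lemma linear_trace_char sg : linear_ok sg ->
  exists2 lam : 'CF(syl), lam \is a linear_char & takes lam (linear_trace sg).
Proof.
move=> ok; have [lam Nlam lamE] := monomial_trace_char ok.
exists lam => //; rewrite qualifE /= Nlam lamE // code1.
have /and3P[_ /allP/(_ tt (mem_head _ _))/andP[_ /negPf sg1] _] := ok.
by rewrite /linear_trace /monomial_trace /= sg1.
Qed.

(** An invariant psi is constant on each fusion class, so it is orthogonal to
    every function whose sum over each fusion class is zero. *)
Lemma fusion_null (psi : 'CF(syl)) (d : seq nat -> int) :
    finvariant fusion10 psi ->
    all (fun t => dot d (fun s => (fix_type s == t)%:R%R) == 0%R)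
      (undup (map fix_type syl_codes)) ->
  (\sum_(x in syl) psi x * (d (code x))%:~R = 0)%R.
Proof.
move/fusion10_invariantP => inv /allP null.
pose cl x := [set y in syl | fix_type (code y) == fix_type (code x)].
rewrite (partition_big_imset cl) big1 //= => _ /imsetP[x0 Px0 ->].
have null0 : dot d (fun s => (fix_type s == fix_type (code x0))%:R%R) = 0%R.
  by apply/eqP/null; rewrite mem_undup map_f ?code_syl.
have clE x : x \in syl ->
    (cl x == cl x0) = (fix_type (code x) == fix_type (code x0)).
  move=> Px; apply/eqP/eqP=> [/setP/(_ x)|eqx]; last by rewrite /cl eqx.
  by rewrite !inE Px eqxx => /esym/eqP.
transitivity (psi x0 * (dot d (fun s =>
    (fix_type s == fix_type (code x0))%:R%R))%:~R : algC)%R; last first.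
  by rewrite null0 mulr0.
rewrite dotE rmorph_sum -sum_syl mulr_sumr big_mkcondr.
apply: eq_bigr => x Px; rewrite clE //=.
rewrite intrM; case: eqP => [eqx|_]; last by rewrite !mulr0.
by rewrite mulr1 (inv x x0).
Qed.

(** * The characters involved *)

(** Whether s reverses the order of the two points of block i. *)
Definition bottom (s : seq nat) (i : nat) : bool := odd (nth 0 s i.*2).
(** Whether s sends the first block of half h to the second block of a half. *)
Definition middle (s : seq nat) (h : nat) : bool := odd (nth 0 s (4 * h)%N)./2.
(** The signs a, b and c; the first is also the signature of the action on the
    points 0, ..., 7. *)
Definition sgn_a (s : seq nat) : bool := nth 0 s 8 != 8.
Definition sgn_b (s : seq nat) : bool := middle s 0 (+) middle s 1.
Definition sgn_c (s : seq nat) : bool := 4 <= nth 0 s 0.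

(** The subsets with two elements of {0, ..., 7}, as increasing pairs. *)
Definition pairs8 : seq (nat * nat) :=
  [seq (i, j) | j <- iota 0 8, i <- iota 0 j].
Definition pair_act (s : seq nat) (p : nat * nat) : nat * nat :=
  let i := nth 0 s p.1 in let j := nth 0 s p.2 in (minn i j, maxn i j).

Definition pairs_trace := monomial_trace pairs8 pair_act (fun _ _ => false).
(** The permutation character on {0, ..., 7}, multiplied by the sign a. *)
Definition points_trace :=
  monomial_trace (iota 0 8) (nth 0%N) (fun s _ => sgn_a s).

(** A character of degree 4 on the blocks: it is induced from the character of
    the base group which on one half is the representation of degree 2 of the
    dihedral group, and on the other half the product of its signs a and b. *)
Definition block_act (s : seq nat) (i : nat) : nat := (nth 0 s i.*2)./2.
Definition block_sgn (s : seq nat) (i : nat) : bool :=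
  let h := (1 - i./2)%N in
  bottom s i (+) bottom s h.*2 (+) bottom s h.*2.+1 (+) middle s h.
Definition rho_trace := monomial_trace (iota 0 4) block_act block_sgn.

Definition sgn_1 (s : seq nat) : bool := false.
Definition sgn_ac s := sgn_a s (+) sgn_c s.
Definition sgn_ab s := sgn_a s (+) sgn_b s.
Definition sgn_bc s := sgn_b s (+) sgn_c s.
Definition sgn_abc s := sgn_ab s (+) sgn_c s.

(** Each summand is visibly a character minus some of its constituents: the
    pairs of {0, ..., 7} form three orbits under P, and the points one orbit.
    This is pi_2 - pi_1 - 3, because on {8, 9} the permutation character is
    1 + a, so that with q and r the permutation characters on the pairs and on
    the points of {0, ..., 7},
       pi_2 = q + r (1 + a) + 1   and   pi_1 = r + 1 + a. *)
Definition chi_trace (s : seq nat) : int :=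
  (pairs_trace s - linear_trace sgn_1 s *+ 3
    + (points_trace s - linear_trace sgn_a s))%R.

Lemma chi_char :
  exists2 chi : 'CF(syl), chi \is a character & takes chi chi_trace.
Proof.
have [pi2 Npi2 pi2E] : exists2 phi : 'CF(syl), phi \is a character
    & takes phi pairs_trace by apply: monomial_trace_char; vm_compute.
have [pi1 Npi1 pi1E] : exists2 phi : 'CF(syl), phi \is a character
    & takes phi points_trace by apply: monomial_trace_char; vm_compute.
have [lam1 Nlam1 lam1E] : exists2 lam : 'CF(syl), lam \is a linear_char
    & takes lam (linear_trace sgn_1) by apply: linear_trace_char; vm_compute.
have [lama Nlama lamaE] : exists2 lam : 'CF(syl), lam \is a linear_char
    & takes lam (linear_trace sgn_a) by apply: linear_trace_char; vm_compute.
exists (pi2 - lam1 *+ 3 + (pi1 - lama))%R.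
  apply: rpredD.
    apply: (@char_subr_lin _ _ _ _ 3) => //.
    by apply: (takes_cfdot (n := 3) pi2E lam1E); vm_compute.
  rewrite -[lama]mulr1n; apply: (@char_subr_lin _ _ _ _ 1) => //.
  by apply: (takes_cfdot (n := 1) pi1E lamaE); vm_compute.
move=> x Px; rewrite !cfunE pi2E // pi1E // lam1E // lamaE //.
rewrite /chi_trace; move: (pairs_trace _) (linear_trace sgn_1 _).
move: (points_trace _) (linear_trace sgn_a _) => n m k l.
by rewrite mulrS mulr2n !(intrD, intrN).
Qed.

(** * A linear relation between multiplicities *)

(** For functions on codes which need not be characters, such as the relation
    below, this is the scalar product with psi. *)
Definition multiplicity (psi : 'CF(syl)) (z : seq nat -> int) : algC :=
  (128%:R^-1 * \sum_(x in syl) psi x * (z (code x))%:~R)%R.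

Lemma multiplicityE psi phi z :
  takes phi z -> multiplicity psi z = ('[psi, phi])%R.
Proof.
move=> phiE; rewrite cfdotE card_syl; congr (_ * _)%R.
by apply: eq_bigr => x Px; rewrite phiE // rmorph_int.
Qed.

Definition combination (l : seq (int * (seq nat -> int))) (s : seq nat) : int :=
  foldr (fun cz v => cz.1 * cz.2 s + v)%R 0%R l.

Lemma multiplicity_cons psi c z l :
  multiplicity psi (combination ((c, z) :: l))
    = (c%:~R * multiplicity psi z + multiplicity psi (combination l))%R.
Proof.
rewrite /multiplicity mulrCA -mulrDr; congr (_ * _)%R.
rewrite mulr_sumr -big_split; apply: eq_bigr => x _ /=.
by rewrite intrD intrM mulrDr mulrCA.
Qed.

Lemma multiplicity_eq0 psi l :
    (forall cz, List.In cz l -> multiplicity psi cz.2 = 0%R) ->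
  multiplicity psi (combination l) = 0%R.
Proof.
elim: l => [_ | [c z] l IHl orth].
  by rewrite /multiplicity big1 ?mulr0 // => x _; rewrite mulr0.
rewrite multiplicity_cons (orth (c, z)) ?mulr0 ?add0r; last by left.
by apply: IHl => cz l_cz; apply: orth; right.
Qed.

Definition reg_trace (s : seq nat) : int :=
  (if s == iota 0 10 then 128 else 0)%R.

Lemma multiplicity_reg psi : multiplicity psi reg_trace = psi 1.
Proof.
rewrite /multiplicity (bigD1 1) //= big1 => [|x /andP[_ x1]].
  by rewrite code1 addr0 mulrCA mulVf ?mulr1 // pnatr_eq0.
by rewrite /reg_trace -code1 (inj_eq code_inj) (negPf x1) mulr0.
Qed.

(** Six characters orthogonal to chi, with their coefficients in the relation.
    These solve the linear system which says that the total, together with the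
    regular character minus 32 times a c, has sum zero over each of the seven
    fusion classes. *)
Definition tests : seq (int * (seq nat -> int)) :=
  [:: ((-1)%R, linear_trace sgn_1); ((-8)%R, linear_trace sgn_a);
      (4%R, linear_trace sgn_bc); ((-23)%R, linear_trace sgn_ab);
      ((-44)%R, linear_trace sgn_abc); ((-6)%R, rho_trace)].

Definition relation : seq nat -> int :=
  combination [:: (1%R, reg_trace), ((-32)%R, linear_trace sgn_ac) & tests].

Lemma relation_null : all (fun t =>
    dot relation (fun s => (fix_type s == t)%:R%R) == 0%R)
  (undup (map fix_type syl_codes)).
Proof. by vm_compute. Qed.

Lemma degree_face psi : finvariant fusion10 psi ->
    (forall cz, List.In cz tests -> multiplicity psi cz.2 = 0%R) ->
  psi 1 = (32 * multiplicity psi (linear_trace sgn_ac))%R.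
Proof.
move=> /fusion_null/(_ relation_null) null /multiplicity_eq0 orth.
have : multiplicity psi relation = 0%R by rewrite /multiplicity null mulr0.
rewrite 2!multiplicity_cons orth multiplicity_reg addr0 mul1r => /eqP.
by rewrite addr_eq0 => /eqP->; rewrite intrN mulNr opprK.
Qed.

Lemma chi_invariant chi : takes chi chi_trace -> finvariant fusion10 chi.
Proof.
move=> chiE; apply/fusion10_invariantP => x y Px Py eqxy; rewrite !chiE //.
have: let types := map fix_type syl_codes in
      all (fun s => chi_trace s ==
        chi_trace (nth [::] syl_codes (index (fix_type s) types))) syl_codes.
  by vm_compute.
cbv zeta; move/allP => chi_rep.
by rewrite (eqP (chi_rep _ (code_syl Px))) (eqP (chi_rep _ (code_syl Py))) eqxy.
Qed.

Lemma test_char cz : List.In cz tests ->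
  exists2 phi : 'CF(syl), phi \is a character & takes phi cz.2.
Proof.
do 6![case=> [<-|]; first by apply: monomial_trace_char; vm_compute].
by [].
Qed.

(** * The counterexample *)

Lemma cfdot_cfReg (gT : finGroupType) (P : {group gT}) (phi : 'CF(P)) :
  ('[cfReg P, phi] = (phi 1%g)^*)%R.
Proof.
rewrite cfdotE (bigD1 1) //= big1 => [|x /andP[_ /negPf x1]].
  by rewrite cfRegE eqxx addr0 mulKf ?neq0CG.
by rewrite cfRegE x1 mul0r.
Qed.

Lemma sub_orthogonal (psi1 psi2 phi : 'CF(syl)) :
    psi1 \is a character -> psi2 \is a character -> phi \is a character ->
  ('[psi1 + psi2, phi] = 0 -> '[psi1, phi] = 0)%R.
Proof.
move=> N1 N2 Nphi; rewrite cfdotDl => /eqP.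
have /natr_ge0 ge1 := Cnat_cfdot_char N1 Nphi.
have /natr_ge0 ge2 := Cnat_cfdot_char N2 Nphi.
by rewrite paddr_eq0 // => /andP[/eqP].
Qed.

Theorem mainTheorem3 :
  exists (p : nat) (gT : finGroupType) (P : {group gT})
         (F : fusion_system P),
    [/\ prime p, (p.-group P)%g, saturated F p
      & exists chi : 'CF(P),
          findecomposable F chi /\ ~ char_summand chi (cfReg P)].
Proof.
exists 2, {perm 'I_10}, syl, fusion10; split=> //.
- exact: pHall_pgroup syl_Sylow.
- exact: group_fusion_saturated syl_Sylow.
have [chi Nchi chiE] := chi_char.
have chi_inv := chi_invariant chiE.
have [lac Nlac lacE] : exists2 lam : 'CF(syl), lam \is a linear_char
    & takes lam (linear_trace sgn_ac) by apply: linear_trace_char; vm_compute.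
have [lc Nlc lcE] : exists2 lam : 'CF(syl), lam \is a linear_char
    & takes lam (linear_trace sgn_c) by apply: linear_trace_char; vm_compute.
have chi_ac : ('[chi, lac] = 1)%R.
  by apply: (takes_cfdot (n := 1) chiE lacE); vm_compute.
have chi_c : ('[chi, lc] = 2%:~R)%R.
  by apply: (takes_cfdot (n := 2) chiE lcE); vm_compute.
have chi_test cz : List.In cz tests -> dot chi_trace cz.2 = 0%R.
  by do 6![case=> [<-|]; first by vm_compute].
exists chi; split; last first.
  move=> Nreg; have := Cnat_cfdot_char Nreg (lin_charW Nlc).
  by rewrite cfdotBl chi_c cfdot_cfReg lin_char1 // conjC1 -[1%R]/(1%:~R)%R
    -intrB => /natr_ge0; rewrite ler0z.
split.
  split=> //; apply/eqP=> chi0; move: chi_ac; rewrite chi0 cfdot0l => /eqP.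
  by rewrite eq_sym oner_eq0.
(* A summand orthogonal to a c has degree 0, by the linear relation. *)
have part psi1 psi2 : finv_char fusion10 psi1 -> finv_char fusion10 psi2 ->
    chi = (psi1 + psi2)%R -> ('[psi1, lac] != 0)%R.
  case=> N1 nz1 inv1 [N2 _ _] def_chi; apply: contraNneq nz1 => orth_ac.
  rewrite -char1_eq0 // degree_face // ?(multiplicityE _ lacE) ?orth_ac
    ?mulr0 //.
  move=> cz test_cz.
  have [phi Nphi phiE] := test_char test_cz.
  rewrite (multiplicityE _ phiE); apply: (sub_orthogonal N1 N2 Nphi).
  rewrite -def_chi; apply: (takes_cfdot (n := 0) chiE phiE).
  by rewrite chi_test.
case=> psi1 [psi2 [inv1 inv2 def_chi]].
have nz1 := part _ _ inv1 inv2 def_chi.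
have nz2 : ('[psi2, lac] != 0)%R by apply: part inv2 inv1 _; rewrite addrC.
move: chi_ac; rewrite def_chi cfdotDl.
have [N1 _ _] := inv1; have [N2 _ _] := inv2.
have /natrP[m1 def1] := Cnat_cfdot_char N1 (lin_charW Nlac).
have /natrP[m2 def2] := Cnat_cfdot_char N2 (lin_charW Nlac).
move: nz1 nz2; rewrite def1 def2 !pnatr_eq0 -natrD => nz1 nz2 /eqP.
rewrite -[1%R]/(1%:R)%R eqr_nat.
by case: m1 m2 nz1 nz2 {def1 def2} => [|m1] [|m2] //; rewrite addSn addnS.
Qed.
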